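(* Let $(X,\Sigma,\mu)$ be a $\sigma$-finite complete measure space with decomposition $X=\left(\bigcup_{n\in\mathbb{N}}A_n\right)\cup B$ into atoms $A_n$ and non-atomic part $B$. Let $T:X\to X$ be a nonsingular measurable transformation with $f_0=\frac{d(\mu\circ T^{-1})}{d\mu}$, and let $\Phi_1,\Phi_2$ be Young functions such that $\Phi_2\not\prec\Phi_1$. If $T$ induces a (bounded) composition operator $C_T:L^{\Phi_1}(\Sigma)\to L^{\Phi_2}(\Sigma)$, $C_Tf=f\circ T$, then (i) $f_0(x)=0$ for $\mu$-almost all $x\in B$; (ii) $\sup_{n\in\mathbb{N}}\dfrac{\Phi_1^{-1}\left(\frac{1}{\mu(A_n)}\right)}{\Phi_2^{-1}\left(\frac{1}{f_0(A_n)\mu(A_n)}\right)}<\infty$.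
   Context: A Young function is a continuous convex function $\Phi:\mathbb{R}\to\mathbb{R}$ such that $\Phi(x)=0$ if and only if $x=0$, $\Phi(-x)=\Phi(x)$, $\lim_{x\to\infty}\Phi(x)/x=\infty$ and $\lim_{x\to\infty}\Phi(x)=\infty$; $\Phi^{-1}$ denotes the inverse of its restriction to $[0,\infty)$. $\Phi_2\prec\Phi_1$ means there are $a\ge0$ and $x_0\ge0$ with $\Phi_2(x)\le\Phi_1(ax)$ for all $x\ge x_0$; $\Phi_2\not\prec\Phi_1$ is its negation. $L^0(\Sigma)$ is the space of $\mu$-a.e. equivalence classes of scalar-valued $\Sigma$-measurable functions on $X$; $\Phi(f)$ means $\Phi(|f|)$. $L^{\Phi}(\Sigma)=\{f\in L^0(\Sigma): \exists k>0,\ \int_X\Phi(kf)\,d\mu<\infty\}$ with norm $\|f\|_\Phi=\inf\{k>0:\int_X\Phi(f/k)\,d\mu\le1\}$. A measurable $T:X\to X$ is nonsingular if $\mu(A)=0$ implies $\mu(T^{-1}(A))=0$; then $f_0$ is the nonnegative locally integrable function with $\mu(T^{-1}(A))=\int_Af_0\,d\mu$ for all $A\in\Sigma$. An atom is a set $A\in\Sigma$ with $\mu(A)>0$ such that every measurable $F\subseteq A$ has $\mu(F)=0$ or $\mu(F)=\mu(A)$. A $\sigma$-finite measure space decomposes uniquely as $X=(\bigcup_nA_n)\cup B$ with $\{A_n\}$ a countable family of pairwise disjoint atoms (each of finite measure) and $B$, disjoint from all $A_n$, containing no atoms. $f_0(A_n)$ is the a.e. constant value of $f_0$ on $A_n$;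 when $f_0(A_n)=0$ the quotient in (ii) is read as $0$ (convention $1/0=\infty$, $\Phi_2^{-1}(\infty)=\infty$). *)

(* Defs.v *)
From HB Require Import structures.
From mathcomp Require Import all_boot all_order all_algebra.
From mathcomp Require Import all_classical all_reals all_analysis.

Set Implicit Arguments.
Unset Strict Implicit.
Unset Printing Implicit Defensive.

Import Order.TTheory GRing.Theory Num.Theory.
Import numFieldNormedType.Exports.

Local Open Scope classical_set_scope.
Local Open Scope ring_scope.
Local Open Scope quotient_scope.

Section young.
Context {R : realType}.
Implicit Types Phi : R -> R.

Record young_function Phi : Prop := YoungFunction {
  young_continuous : continuous Phi;
  young_convex : convex_function (setT : set R) Phi;
  young_eq0 : forall x, Phi x = 0 <-> x = 0;
  young_even : forall x, Phi (- x) = Phi x;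
  young_superlinear : Phi x / x @[x --> +oo] --> +oo;
  young_cvgy : Phi x @[x --> +oo] --> +oo }.

Definition young_inv Phi : R -> R := 'pinv_(fun=> 0) `[0, +oo[ Phi.

(* [er_map] fixes [+oo], which is the convention Phi^-1(+oo) = +oo. *)
Definition eyoung_inv Phi : \bar R -> \bar R := er_map (young_inv Phi).

Definition young_prec Phi2 Phi1 : Prop :=
  exists a x0 : R, [/\ 0 <= a, 0 <= x0 &
    forall x, x0 <= x -> Phi2 x <= Phi1 (a * x)].

End young.

Section measure_space.
Context {d : measure_display} {X : measurableType d} {R : realType}.
Variable mu : {measure set X -> \bar R}.

Definition atom (A : set X) : Prop :=
  [/\ measurable A, (0 < mu A)%E &
    forall F, measurable F -> F `<=` A -> mu F = 0%E \/ mu F = mu A].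

(* The atoms are indexed by a set [I] of naturals, so that their family may be
   empty, finite or infinite; [A n] is irrelevant for [n] outside [I]. *)
Record atomic_decomposition (I : set nat) (A : nat -> set X) (B : set X) :
    Prop := AtomicDecomposition {
  decomposition_atom : forall n, I n -> atom (A n);
  decomposition_fin : forall n, I n -> (mu (A n) < +oo)%E;
  decomposition_trivIset : trivIset I A;
  decomposition_measurable : measurable B;
  decomposition_disjoint : forall n, I n -> A n `&` B = set0;
  decomposition_nonatomic : forall C, C `<=` B -> ~ atom C;
  decomposition_cover : \bigcup_(n in I) A n `|` B = setT }.

Definition nonsingular (T : X -> X) : Prop :=
  forall A, measurable A -> mu A = 0%E -> mu (T @^-1` A) = 0%E.

(* [f0] is a version of the density of A |-> mu (T^-1(A)) with respect to [mu];
   locally integrable means integrable on the sets of finite measure. *)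
Record density_of_preimage (T : X -> X) (f0 : X -> R) : Prop :=
    DensityOfPreimage {
  density_measurable : measurable_fun setT f0;
  density_ge0 : forall x, 0 <= f0 x;
  density_locally_integrable : forall A, measurable A -> (mu A < +oo)%E ->
    mu.-integrable A (EFin \o f0);
  density_eq : forall A, measurable A ->
    mu (T @^-1` A) = (\int[mu]_(x in A) (f0 x)%:E)%E }.

(* The almost everywhere constant value of [f] on [A]; 0 if there is none. *)
Definition ae_value (f : X -> R) (A : set X) : R :=
  xget 0 [set c | {ae mu, forall x, A x -> f x = c}].

Local Notation L0 := {mfun_ mu, X >-> R}.

Definition orlicz_space (Phi : R -> R) : set L0 :=
  [set f | exists2 k : R, 0 < k & (\int[mu]_x (Phi `|k * f x|)%:E < +oo)%E].

Definition orlicz_norm (Phi : R -> R) (f : L0) : R :=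
  inf [set k : R | 0 < k /\ (\int[mu]_x (Phi `|f x / k|)%:E <= 1)%E].

(* The class of [f \o T]. It is computed from the canonical representative of
   the class of [f]; [composition_pi] below shows that any other representative
   gives the same class when [T] is nonsingular. *)
Definition composition (T : {mfun X >-> X}) (f : L0) : L0 :=
  \pi_L0 (repr f \o T).

Lemma composition_pi (T : {mfun X >-> X}) (f : {mfun X >-> R}) :
  nonsingular T ->
  composition T (\pi_L0 f) = \pi_L0 (f \o T).
Proof.
move=> nsT; rewrite /composition; apply/eqmodP/asboolP.
have /eqmodP/asboolP[N [mN N0 sN]] : repr (\pi_L0 f) = f %[mod L0].
  by rewrite reprK.
exists (T @^-1` N); split; last by move=> x /= xN; exact: sN.
  by rewrite -[_ @^-1` _]setTI; exact: measurable_funPT.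
exact: nsT.
Qed.

Definition bounded_composition (Phi1 Phi2 : R -> R) (T : {mfun X >-> X}) :
    Prop :=
  (forall f, orlicz_space Phi1 f -> orlicz_space Phi2 (composition T f)) /\
  exists M : R, forall f, orlicz_space Phi1 f ->
    orlicz_norm Phi2 (composition T f) <= M * orlicz_norm Phi1 f.

End measure_space.

(* Main.v *)
(* Write S for the preimage of a set F under T. The indicator of F has Orlicz
   norm 1 / Phi^-1(1 / mu F), and C_T sends it to the indicator of S, so that
   boundedness of C_T by M gives
     Phi1^-1(1 / mu F) <= M Phi2^-1(1 / mu S)
   whenever both measures are positive and finite. For F an atom this is (ii).
   For (i), if f0 were at least e > 0 on a nonnegligible part E of B, then E
   would contain, for every large x, a set F with mu F in ]a/2, a] where
   a = 1 / Phi1(M x). Since mu S >= e mu F, the above inequality would give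
   Phi2(x) <= (2 / e) Phi1(M x), which is at most Phi1(max(1, 2 / e) M x) by
   convexity, i.e. Phi2 would be dominated by Phi1. *)
Require Import Defs.
From HB Require Import structures.
From mathcomp Require Import all_boot all_order all_algebra.
From mathcomp Require Import all_classical all_reals all_analysis.
From mathcomp Require Import measurable_realfun lra.

Set Implicit Arguments.
Unset Strict Implicit.
Unset Printing Implicit Defensive.

Import Order.TTheory GRing.Theory Num.Theory.
Import numFieldNormedType.Exports.

Local Open Scope classical_set_scope.
Local Open Scope ring_scope.

(** * Monotonicity of Young functions and their inverses on the half-line *)

Section young_theory.
Context {R : realType} (Phi : R -> R) (yPhi : young_function Phi).

Lemma young0 : Phi 0 = 0.
Proof. by apply/(young_eq0 yPhi). Qed.

Lemma young_convex_le (t x y : R) : 0 <= t <= 1 ->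
  Phi (t * x + (1 - t) * y) <= t * Phi x + (1 - t) * Phi y.
Proof.
move=> /andP[t0 t1].
exact: (young_convex yPhi (Itv01 t0 t1) (mem_set (I : setT x))
  (mem_set (I : setT y))).
Qed.

Lemma young_scale_le (t x : R) : 0 <= t <= 1 -> Phi (t * x) <= t * Phi x.
Proof.
by move=> /(young_convex_le x 0); rewrite young0 !mulr0 !addr0.
Qed.

Lemma young_scale_ge (k x : R) : 1 <= k -> k * Phi x <= Phi (k * x).
Proof.
move=> k1; have k0 : 0 < k by exact: lt_le_trans k1.
rewrite -ler_pdivlMl// -{1}(mulKf (lt0r_neq0 k0) x).
by apply: young_scale_le; rewrite invr_ge0 ltW//= invf_le1.
Qed.

(** Since 0 is the midpoint of [x] and [- x], convexity and evenness give [Phi 0 <= Phi x]. *)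
Lemma young_ge0 (x : R) : 0 <= Phi x.
Proof.
have h : 0 <= (2^-1 : R) <= 1 by apply/andP; split; lra.
have := young_convex_le x (- x) h.
rewrite (young_even yPhi) (_ : _ + _ = 0) ?young0; last lra.
by move=> ?; lra.
Qed.

Lemma young_gt0 (x : R) : x != 0 -> 0 < Phi x.
Proof.
move=> x0; rewrite lt_neqAle young_ge0 andbT eq_sym.
by apply: contra x0 => /eqP /(young_eq0 yPhi) ->.
Qed.

(** Writing [x] as [x / y] times [y], convexity gives at most [x / y * Phi y], where [x / y < 1] and
    [Phi y > 0]. *)
Lemma young_lt (x y : R) : 0 <= x -> x < y -> Phi x < Phi y.
Proof.
move=> x0 xy; have y0 : 0 < y by exact: le_lt_trans xy.
apply: (@le_lt_trans _ _ (x / y * Phi y)).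
  rewrite -{1}(divfK (lt0r_neq0 y0) x) young_scale_le//.
  by rewrite divr_ge0 ?(ltW y0)//= ler_pdivrMr// mul1r ltW.
by rewrite gtr_pMl ?young_gt0 ?gt_eqF// ltr_pdivrMr// mul1r.
Qed.

Lemma young_le (x y : R) : 0 <= x -> x <= y -> Phi x <= Phi y.
Proof.
move=> x0; rewrite le_eqVlt => /predU1P[->//|xy].
exact/ltW/young_lt.
Qed.

Lemma young_le_inv (x y : R) : 0 <= y -> Phi x <= Phi y -> x <= y.
Proof.
by move=> y0 xy; rewrite leNgt; apply/negP => /(young_lt y0); rewrite ltNge xy.
Qed.

Lemma young_unbounded (M : R) : exists2 x0, 0 <= x0 &
  forall x, x0 <= x -> M <= Phi x.
Proof.
have /cvgryPge/(_ M)[N [Nr NM]] := young_cvgy yPhi.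
(* The limit gives the bound only strictly beyond [N], which may be negative. *)
exists (`|N| + 1); first by rewrite addr_ge0.
move=> x Nx; apply: NM; apply: lt_le_trans Nx.
by rewrite ltr_pwDr// ler_norm.
Qed.

(** By the intermediate value theorem [Phi] maps the half-line onto itself, and a partial inverse of
    a surjection is a right inverse. *)
Lemma young_invP (t : R) : 0 <= t ->
  0 <= young_inv Phi t /\ Phi (young_inv Phi t) = t.
Proof.
move=> t0; have [x0 x00 /(_ _ (lexx _)) x0t] := young_unbounded t.
have surj : set_surj `[0, +oo[ `[0, +oo[ Phi.
  move=> s /=; rewrite in_itv/= andbT => s0.
  have [y y0 /(_ _ (lexx _)) ys] := young_unbounded s.
  have [||c cy <-] := @IVT _ Phi 0 y s y0.
  - by apply: continuous_subspaceT; exact: young_continuous yPhi.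
  - by rewrite young0 (min_idPl (young_ge0 y)) (max_idPr (young_ge0 y)) s0.
  by exists c => //=; move: cy; rewrite !in_itv/= => /andP[->].
have tin : t \in (`[0, +oo[%classic : set R).
  by rewrite inE/= in_itv/= t0.
split; last exact: (surjpK _ surj).
have : `[0, +oo[%classic (young_inv Phi t).
  by apply: (surjpinv_image_sub surj); exists t => //; exact: set_mem.
by rewrite /= in_itv/= andbT.
Qed.

Lemma young_inv_gt0 (t : R) : 0 < t -> 0 < young_inv Phi t.
Proof.
move=> t0; have [i0 it] := young_invP (ltW t0).
rewrite lt_neqAle i0 andbT; apply: contraTneq t0 => i00.
by rewrite -it -i00 young0 ltxx.
Qed.

End young_theory.

(** * Intermediate measures in the non-atomic part *)

Section nonatomic.
Context {d : measure_display} {X : measurableType d} {R : realType}.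
Variables (mu : {measure set X -> \bar R}) (B : set X).
Hypothesis B_nonatomic : forall C, C `<=` B -> ~ atom mu C.

(** As [E] is not an atom, it splits into two pieces of positive measure; the smaller one serves as
    [G]. *)
Lemma nonatomic_half (E : set X) : measurable E -> E `<=` B ->
  (0 < mu E < +oo)%E -> exists G, [/\ measurable G, G `<=` E, (0 < mu G)%E &
    (mu G <= 2^-1%:E * mu E)%E].
Proof.
move=> mE EB /andP[E0 Eoo]; apply: contrapT => nG.
apply: (B_nonatomic EB); split => // F mF FE.
have mD : measurable (E `\` F) by exact: measurableD.
have EDF : mu E = (mu (E `\` F) + mu F)%E.
  by rewrite (measureDI mu mE mF) (setIidr FE).
have [F0|F0] := eqVneq (mu F) 0%E; [by left|right].
have [D0|D0] := eqVneq (mu (E `\` F)) 0%E; first by rewrite EDF D0 add0e.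
have Ffin : mu F \is a fin_num.
  by rewrite ge0_fin_numE// (le_lt_trans _ Eoo)// le_measure ?inE.
have Dfin : mu (E `\` F) \is a fin_num.
  by rewrite ge0_fin_numE// (le_lt_trans _ Eoo)// le_measure ?inE.
exfalso; apply: nG; have [FD|DF] := leP (mu F) (mu (E `\` F)).
  exists F; split; rewrite ?lt0e ?F0 ?measure_ge0//.
  move: FD; rewrite EDF -(fineK Ffin) -(fineK Dfin) -EFinD -EFinM !lee_fin.
  by move=> ?; lra.
exists (E `\` F); split; rewrite ?lt0e ?D0 ?measure_ge0//.
move: DF; rewrite EDF -(fineK Ffin) -(fineK Dfin) -EFinD -EFinM lee_fin lte_fin.
by move=> ?; lra.
Qed.

(** Halving [n] times leaves a set of positive measure at most [2^-n * mu E], which drops below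
    [e]. *)
Lemma nonatomic_small (E : set X) (e : R) : measurable E -> E `<=` B ->
  (0 < mu E < +oo)%E -> 0 < e -> exists G,
  [/\ measurable G, G `<=` E, (0 < mu G)%E & (mu G <= e%:E)%E].
Proof.
move=> mE EB Epoo e0; have /andP[E0 Eoo] := Epoo.
have Efin : mu E \is a fin_num by rewrite ge0_fin_numE.
have halves n : exists G, [/\ measurable G, G `<=` E, (0 < mu G)%E &
    (mu G <= (2^-1 ^+ n)%:E * mu E)%E].
  elim: n => [|n [G [mG GE G0 Gn]]].
    by exists E; split => //; rewrite expr0 mul1e.
  have Goo : (mu G < +oo)%E by rewrite (le_lt_trans _ Eoo)// le_measure ?inE.
  have [|||H [mH HG H0 Hn]] := @nonatomic_half G => //.
  - exact: subset_trans EB.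
  - by rewrite G0.
  exists H; split => //; first exact: subset_trans GE.
  apply: (le_trans Hn); rewrite exprS EFinM -muleA.
  by rewrite lee_pmul2l// lte_fin invr_gt0.
pose m := fine (mu E); have m0 : 0 < m by rewrite fine_gt0// E0.
have : (2^-1 : R) ^+ n @[n --> \oo] --> 0.
  by apply: cvg_expr; rewrite ger0_norm// invf_lt1// ltr1n.
move=> /cvgrPdist_lt /(_ (e / m)) []; first by rewrite divr_gt0.
move=> n _ /(_ n (leqnn n)); rewrite sub0r normrN ger0_norm// => ne.
have [G [mG GE G0 Gn]] := halves n; exists G; split => //.
apply: (le_trans Gn); rewrite -(fineK Efin) -EFinM lee_fin.
by rewrite -ler_pdivlMr// ltW.
Qed.

(* If no set had measure in ]a/2, a], the sets of measure at most a/2 would be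
   closed under unions, hence one of them would have maximal measure; a small
   set in its complement could then be added to it. *)
Lemma nonatomic_between (E : set X) (a : R) : measurable E -> E `<=` B ->
  (mu E < +oo)%E -> 0 < a -> (a%:E < mu E)%E -> exists F,
  [/\ measurable F, F `<=` E, ((a / 2)%:E < mu F)%E & (mu F <= a%:E)%E].
Proof.
move=> mE EB Eoo a0 aE; apply: contrapT => nF.
pose small F := [/\ measurable F, F `<=` E & (mu F <= (a / 2)%:E)%E].
have small_of F : measurable F -> F `<=` E -> (mu F <= a%:E)%E -> small F.
  move=> mF FE Fa; split => //; rewrite leNgt; apply/negP => aF.
  by apply: nF; exists F.
(* The union has measure at most [a], and the gap in []a/2, a]] pushes it down to [a/2]. *)
have smallU F G : small F -> small G -> small (F `|` G).
  move=> [mF FE Fa] [mG GE Ga]; apply: small_of.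
  - exact: measurableU.
  - by rewrite subUset.
  - apply: (le_trans (measureU2 _ mF mG)).
    rewrite [leRHS](_ : _ = (a / 2)%:E + (a / 2)%:E)%E ?leeD//.
    by rewrite -EFinD -splitr.
have small0 : small set0.
  by split => //; rewrite measure0 lee_fin divr_ge0// ltW.
have small_fin F : small F -> mu F \is a fin_num.
  by move=> [mF _ Fa]; rewrite ge0_fin_numE// (le_lt_trans Fa)// ltry.
(* Finite unions are small by [smallU]; continuity from below passes to the limit. *)
have small_bigcup (F : nat -> set X) :
    (forall n, small (F n)) -> small (\bigcup_n F n).
  move=> sF; pose U n := \big[setU/set0]_(i < n.+1) F i.
  have sU n : small (U n) by apply: big_ind => //.
  have mF n : measurable (F n) by have [] := sF n.
  have mU n : measurable (U n) by have [] := sU n.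
  have UE : \bigcup_n U n = \bigcup_n F n by exact: bigcup_bigsetU_bigcup.
  split; [exact: bigcupT_measurable | |].
    by apply: bigcup_sub => n _; have [] := sF n.
  rewrite -UE; have mUU : measurable (\bigcup_n U n).
    exact: bigcupT_measurable.
  have /cvg_lim <- // : mu (U n) @[n --> \oo] --> mu (\bigcup_n U n).
    apply: nondecreasing_cvg_mu => // n m nm; apply/subsetPset.
    exact: subset_bigsetU.
  apply: lime_le.
    apply: ereal_nondecreasing_is_cvgn => n m nm.
    apply: le_measure; rewrite ?inE//.
    exact: subset_bigsetU.
  by near=> n; have [] := sU n.
pose S := [set fine (mu F) | F in small].
have S0 : S !=set0 by exists (fine (mu set0)), set0.
have Sub : has_ubound S.
  exists (a / 2) => _ [F sF <-]; rewrite -lee_fin fineK ?small_fin//.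
  by case: sF.
have supS : has_sup S by [].
have near_sup n : exists F, small F /\ sup S - n.+1%:R^-1 < fine (mu F).
  have [|_ [F sF <-] Fn] := @sup_adherent _ S n.+1%:R^-1 _ supS.
    by rewrite invr_gt0.
  by exists F.
have {near_sup} [F Fsup] := choice near_sup.
have sF n : small (F n) := (Fsup n).1.
(* The union of a maximizing sequence attains the supremum. *)
pose U := \bigcup_n F n; have sU : small U by exact: small_bigcup.
have [mU UE Ua] := sU.
have SU : sup S <= fine (mu U).
  apply/ler_addgt0Pr => e e0.
  have [n ne] : exists n, n.+1%:R^-1 < e.
    exists (Num.bound e^-1); rewrite -[ltRHS]invrK ltf_pV2 ?posrE ?invr_gt0//.
    rewrite (lt_trans (archi_boundP _))// ?invr_ge0 ?ltW//.
    by rewrite ltr_nat.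
  have := (Fsup n).2; have : fine (mu (F n)) <= fine (mu U).
    apply: fine_le; rewrite ?small_fin//; apply: le_measure; rewrite ?inE//.
      by have [] := sF n.
    exact: bigcup_sup.
  move: ne; set r := _^-1 => *; lra.
have EU : mu E = (mu (E `\` U) + mu U)%E.
  by rewrite (measureDI mu mE mU) (setIidr UE).
have mD : measurable (E `\` U) by exact: measurableD.
have D0 : (0 < mu (E `\` U))%E.
  rewrite lt0e measure_ge0 andbT; apply: contraTneq aE => D0.
  rewrite EU D0 add0e -leNgt (le_trans Ua)// lee_fin; move: a0; lra.
(* [G] is disjoint from [U] and small, so [mu U + mu G] would exceed the maximum. *)
have [|||G [mG GD G0 Ga]] := @nonatomic_small (E `\` U) (a / 2) mD.
- by apply: subset_trans EB; exact: subDsetl.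
- rewrite D0 (le_lt_trans _ Eoo)// le_measure ?inE//; exact: subDsetl.
- by rewrite divr_gt0.
have sG : small G.
  by split => //; apply: subset_trans GD _; exact: subDsetl.
have UG : mu (U `|` G) = (mu U + mu G)%E.
  by apply: measureU => //; apply/seteqP; split => // x [Ux /GD[]].
have : fine (mu (U `|` G)) <= sup S.
  by apply: ub_le_sup => //; exists (U `|` G) => //; exact: smallU.
have : 0 < fine (mu G).
  by rewrite fine_gt0// G0/= (le_lt_trans Ga)// ltry.
rewrite UG fineD ?small_fin//; move: SU; lra.
Unshelve. all: by end_near. Qed.

End nonatomic.

(** * Orlicz norms of indicators *)

Section orlicz_indicator.
Context {d : measure_display} {X : measurableType d} {R : realType}.
Variable mu : {measure set X -> \bar R}.
Context (Phi : R -> R) (yPhi : young_function Phi).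
Local Open Scope quotient_scope.
Local Notation L0 := {mfun_ mu, X >-> R}.
Variables (F : set X) (g : {mfun X >-> R}).
Hypotheses (mF : measurable F) (gF : g = \1_F :> (X -> R)).

Lemma integral_young_indic (c : R) : 0 <= c ->
  (\int[mu]_x (Phi `|c * (\pi_L0 g : L0) x|)%:E = (Phi c)%:E * mu F)%E.
Proof.
move=> c0; have mPhi : measurable_fun setT Phi.
  by apply: continuous_measurable_fun; exact: young_continuous yPhi.
have mint (h : {mfun X >-> R}) :
    measurable_fun setT (fun x => (Phi `|c * h x|)%:E).
  apply/measurable_EFinP; apply: measurableT_comp => //.
  by apply: measurableT_comp => //; exact: measurable_funM.
(* The integrand involves the chosen representative of the class, which agrees with [g] only almost
   everywhere. *)
have /eqmodP/asboolP ggE : repr (\pi_L0 g) = g %[mod L0] by rewrite reprK.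
rewrite (@ae_eq_integral _ _ _ mu setT (fun x => (Phi `|c * g x|)%:E))//.
- under eq_integral => x _.
    rewrite gF (_ : Phi _ = Phi c * \1_F x); first over.
    rewrite indicE; case: (x \in F) => /=.
      by rewrite !mulr1 ger0_norm.
    by rewrite !mulr0 normr0 (young0 yPhi).
  rewrite (@integralZl_indic _ _ _ _ _ _ (fun=> F))//.
    by rewrite integral_indic// setIT.
  by rewrite ltNge (young_ge0 yPhi).
- exact: mint.
- by apply: filterS ggE => x /(_ I) gx _; rewrite -gx.
Qed.

Lemma orlicz_space_indic : (mu F < +oo)%E -> orlicz_space Phi (\pi_L0 g : L0).
Proof.
move=> Foo; exists 1 => //.
by rewrite integral_young_indic// lte_mul_pinfty// lee_fin (young_ge0 yPhi).
Qed.

(** The constraint on [k] reads [Phi k^-1 * mu F <= Phi u * mu F], that is [k^-1 <= u] by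
    monotonicity, so the infimum is attained at [u^-1]. *)
Lemma orlicz_norm_indic (u : R) : 0 < u -> ((Phi u)%:E * mu F = 1)%E ->
  orlicz_norm Phi (\pi_L0 g : L0) = u^-1.
Proof.
move=> u0 uF; rewrite /orlicz_norm; set S := [set k | _].
have integralE k : 0 < k ->
    (\int[mu]_x (Phi `|(\pi_L0 g : L0) x / k|)%:E = (Phi k^-1)%:E * mu F)%E.
  move=> k0; rewrite -integral_young_indic ?invr_ge0 ?ltW//.
  by apply: eq_integral => x _; rewrite mulrC.
have Su : S u^-1.
  by split; [rewrite invr_gt0|rewrite integralE ?invr_gt0// invrK uF].
(* The equation [uF] forces [mu F] to be positive and finite, which allows cancelling it. *)
have F0 : (0 < mu F)%E.
  by rewrite lt0e measure_ge0 andbT; apply/eqP => F0; move: uF;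
    rewrite F0 mule0 => /eqP; rewrite eqe eq_sym oner_eq0.
have Ffin : mu F \is a fin_num.
  rewrite ge0_fin_numE// ltey; apply/eqP => Foo; move: uF.
  by rewrite Foo gt0_muley// lte_fin (young_gt0 yPhi)// gt_eqF.
apply/eqP; rewrite eq_le; apply/andP; split.
  apply: ge_inf => //; exists 0 => k [k0 _]; exact: ltW.
apply: lb_le_inf; first by exists u^-1.
move=> k [k0]; rewrite integralE// -uF lee_pmul2r// lee_fin => /young_le_inv.
by move=> /(_ yPhi (ltW u0)); rewrite -{2}(invrK k) lef_pV2 ?posrE// invr_gt0.
Qed.

Lemma orlicz_norm_indic_inv : (0 < mu F < +oo)%E ->
  orlicz_norm Phi (\pi_L0 g : L0) = (young_inv Phi (fine (mu F))^-1)^-1.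
Proof.
move=> F0oo; have F0 : 0 < fine (mu F) by exact: fine_gt0.
apply: orlicz_norm_indic; first by rewrite (young_inv_gt0 yPhi)// invr_gt0.
rewrite (young_invP yPhi _).2 ?invr_ge0 ?ltW//.
have Ffin : mu F \is a fin_num by rewrite ge0_fin_numE//; case/andP: F0oo.
by rewrite -{2}(fineK Ffin) -EFinM mulVf// gt_eqF.
Qed.

End orlicz_indicator.

(** * Boundedness of the composition operator tested on indicators *)

Section bounded_composition_indicator.
Context {d : measure_display} {X : measurableType d} {R : realType}.
Variable mu : {measure set X -> \bar R}.
Context (Phi1 Phi2 : R -> R).
Hypotheses (young1 : young_function Phi1) (young2 : young_function Phi2).
Variable (T : {mfun X >-> X}).
Hypothesis nsT : nonsingular mu T.
Local Open Scope quotient_scope.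

Lemma bounded_composition_indic : bounded_composition mu Phi1 Phi2 T ->
  exists2 M, 0 < M & forall F, measurable F -> (0 < mu F < +oo)%E ->
    (0 < mu (T @^-1` F) < +oo)%E ->
    young_inv Phi1 (fine (mu F))^-1 <=
    M * young_inv Phi2 (fine (mu (T @^-1` F)))^-1.
Proof.
(* The bound [M] comes without a sign; the maximum with 1 makes it positive. *)
move=> [_ [M normM]]; exists (Num.max M 1); first by rewrite lt_max ltr01 orbT.
move=> F mF muF muTF; have mTF : measurable (T @^-1` F).
  by rewrite -[_ @^-1` _]setTI; exact: measurable_funPT.
have u1 : 0 < young_inv Phi1 (fine (mu F))^-1.
  by rewrite (young_inv_gt0 young1)// invr_gt0 fine_gt0.
have u2 : 0 < young_inv Phi2 (fine (mu (T @^-1` F)))^-1.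
  by rewrite (young_inv_gt0 young2)// invr_gt0 fine_gt0.
have Foo : (mu F < +oo)%E by case/andP: muF.
pose g : {mfun X >-> R} := mindic R mF.
have gF : g = \1_F :> (X -> R) by [].
have := normM _ (orlicz_space_indic young1 mF gF Foo).
rewrite (composition_pi _ nsT) (orlicz_norm_indic_inv young1 mF gF muF).
(* [g \o T] is the indicator of the preimage of [F], so the same norm formula applies. *)
rewrite (orlicz_norm_indic_inv young2 mTF _ muTF)//.
rewrite ler_pdivlMr// ler_pdivrMl// mulrC => le_u.
apply: (le_trans le_u).
by rewrite ler_pM2r// le_max lexx.
Qed.

End bounded_composition_indicator.

(** * The density [f0] and the measure of preimages *)

Section density.
Context {d : measure_display} {X : measurableType d} {R : realType}.
Variables (mu : {measure set X -> \bar R}) (T : X -> X) (f0 : X -> R).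
Hypothesis f0E : density_of_preimage mu T f0.

Lemma measurable_density (D : set X) : measurable_fun D (EFin \o f0).
Proof.
apply/measurable_EFinP; apply: measurable_funTS.
exact: density_measurable f0E.
Qed.

Lemma preimage_fin_num (F : set X) : measurable F -> (mu F < +oo)%E ->
  mu (T @^-1` F) \is a fin_num.
Proof.
move=> mF Foo; rewrite (density_eq f0E)//.
by apply: integrable_fin_num => //; exact: density_locally_integrable f0E _ _ _.
Qed.

Lemma preimage_ge (F : set X) (e : R) : measurable F -> 0 <= e ->
  (forall x, F x -> e <= f0 x) -> (e%:E * mu F <= mu (T @^-1` F))%E.
Proof.
move=> mF e0 ef; rewrite (density_eq f0E)// -integral_cst//.
by apply: ge0_le_integral => //; exact: measurable_density.
Qed.

(* The first case covers the default value of [ae_value], for which the quotient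
   in (ii) is 0; so f0 need not be shown to be constant on atoms. *)
Lemma ae_value_preimage (F : set X) : measurable F ->
  ae_value mu f0 F = 0 \/ mu (T @^-1` F) = ((ae_value mu f0 F)%:E * mu F)%E.
Proof.
move=> mF; rewrite /ae_value; case: xgetP => [c _ fc|_]; [right|by left].
rewrite (density_eq f0E)// -integral_cst//.
apply: ae_eq_integral => //; first exact: measurable_density.
by apply: filterS fc => x fx Fx /=; rewrite fx.
Qed.

(** The part of [B] where [f0 > 0] is covered by countably many sets of finite measure on which
    [f0 >= 1/(n+1)], and each of them is null. *)
Lemma density_ae_eq0 (B : set X) : sigma_finite setT mu -> measurable B ->
  (forall (E : set X) (e : R), measurable E -> E `<=` B -> (mu E < +oo)%E ->
    0 < e -> (forall x, E x -> e <= f0 x) -> mu E = 0%E) ->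
  {ae mu, forall x, B x -> f0 x = 0}.
Proof.
move=> [S ST mS] mB null.
pose E n m := (B `&` f0 @^-1` `[n.+1%:R^-1, +oo[) `&` S m.
have : mu.-negligible (\bigcup_n \bigcup_m E n m).
  apply: negligible_bigcup => n; apply: negligible_bigcup => m.
  have mE : measurable (E n m).
    apply: measurableI; last exact: (mS m).1.
    apply: measurableI => //; rewrite -[_ @^-1` _]setTI.
    exact: (density_measurable f0E).
  apply/negligibleP => //; apply: (null _ n.+1%:R^-1) => //.
  - by move=> x [[]].
  - apply: le_lt_trans (mS m).2; apply: le_measure; rewrite ?inE//.
      exact: (mS m).1.
    by move=> x [].
  - by move=> x [[_ /=]]; rewrite in_itv/= andbT.
apply: negligibleS => x /= /not_implyP[Bx /eqP fx0].
have fx : 0 < f0 x by rewrite lt0r fx0 (density_ge0 f0E).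
have [m _ Sm] : (\bigcup_m S m) x by rewrite -ST.
exists (Num.bound (f0 x)^-1) => //; exists m => //; split => //; split => //=.
rewrite in_itv/= andbT invf_ple ?posrE// ltW//.
by rewrite (lt_trans (archi_boundP _)) ?invr_ge0 ?ltW// ltr_nat.
Qed.

End density.

(** * From the indicator inequality to the two conclusions *)

Section composition_density.
Context {d : measure_display} {X : measurableType d} {R : realType}.
Variables (mu : {measure set X -> \bar R}) (B : set X).
Hypothesis B_nonatomic : forall C, C `<=` B -> ~ atom mu C.
Variables (T : {mfun X >-> X}) (f0 : X -> R).
Hypotheses (nsT : nonsingular mu T) (f0E : density_of_preimage mu T f0).
Variables (Phi1 Phi2 : R -> R).
Hypotheses (young1 : young_function Phi1) (young2 : young_function Phi2).
Hypothesis CT : bounded_composition mu Phi1 Phi2 T.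

Lemma young_prec_nonatomic (E : set X) (e : R) : measurable E -> E `<=` B ->
  (0 < mu E < +oo)%E -> 0 < e -> (forall x, E x -> e <= f0 x) ->
  young_prec Phi2 Phi1.
Proof.
move=> mE EB muE e0 ef; have /andP[E0 Eoo] := muE.
have Efin : mu E \is a fin_num by rewrite ge0_fin_numE.
have m0 : 0 < fine (mu E) by exact: fine_gt0.
have [M M0 indicM] := bounded_composition_indic young1 young2 nsT CT.
(* Beyond [x0] the target measure [1 / Phi1 s] lies below [mu E]; the added 1 makes this strict. *)
have [x0 x00 x0P] := young_unbounded young1 ((fine (mu E))^-1 + 1).
(* The factor [2 / e] is what the estimate yields; [K >= 1] lets convexity move it inside [Phi1]. *)
pose K := Num.max 1 (2 / e).
have K1 : 1 <= K by rewrite le_max lexx.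
have K0 : 0 < K by exact: lt_le_trans K1.
exists (K * M), (x0 / M); split.
- by rewrite mulr_ge0 ?ltW.
- by apply: divr_ge0 => //; exact: ltW.
move=> x; rewrite ler_pdivrMr// mulrC => /[dup] x0x /x0P.
rewrite -mulrA; set s := M * x => Et.
have s0 : 0 <= s by exact: le_trans x0x.
have x_ge0 : 0 <= x by rewrite -(pmulr_rge0 _ M0).
have t0 : 0 < Phi1 s.
  by apply: lt_le_trans Et; rewrite addr_gt0// invr_gt0.
have tE : ((Phi1 s)^-1%:E < mu E)%E.
  rewrite -(fineK Efin) lte_fin invf_plt ?posrE//.
  by apply: lt_le_trans Et; rewrite ltrDl.
have [|F [mF FE tF Ft]] := nonatomic_between B_nonatomic mE EB Eoo _ tE.
  by rewrite invr_gt0.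
have Foo : (mu F < +oo)%E by rewrite (le_lt_trans Ft)// ltry.
have F0 : (0 < mu F)%E.
  by apply: le_lt_trans tF; rewrite lee_fin divr_ge0// invr_ge0 ltW.
have Ffin : mu F \is a fin_num by rewrite ge0_fin_numE.
have r0 : 0 < fine (mu F) by rewrite fine_gt0// F0.
have TFfin := preimage_fin_num f0E mF Foo.
have TFge : e * fine (mu F) <= fine (mu (T @^-1` F)).
  rewrite -lee_fin EFinM !fineK//.
  by apply: (preimage_ge f0E) => //; [exact: ltW|move=> y /FE; exact: ef].
have q0 : 0 < fine (mu (T @^-1` F)).
  by apply: lt_le_trans TFge; rewrite mulr_gt0.
have TF0 : (0 < mu (T @^-1` F))%E by rewrite -(fineK TFfin) lte_fin.
have := indicM F mF; rewrite F0 Foo TF0 -ge0_fin_numE// TFfin.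
move=> /(_ isT isT) u12.
set u1 := young_inv Phi1 _ in u12; set u2 := young_inv Phi2 _ in u12.
have [u10 u1P] := young_invP young1 (ltW (divr_gt0 ltr01 r0)).
have [u20 u2P] := young_invP young2 (ltW (divr_gt0 ltr01 q0)).
rewrite !div1r in u10 u1P u20 u2P.
(* From [mu F <= 1 / Phi1 s] follows [Phi1 s <= 1 / mu F = Phi1 u1]; then
   [M * x = s <= u1 <= M * u2] gives [x <= u2]. *)
have su1 : s <= u1.
  apply: (young_le_inv young1 u10).
  by rewrite u1P -[leLHS]invrK lef_pV2 ?posrE ?invr_gt0// -lee_fin fineK.
have xu2 : x <= u2 by rewrite -(ler_pM2l M0) (le_trans su1).
apply: (le_trans (young_le young2 x_ge0 xu2)); rewrite u2P.
apply: le_trans (young_scale_ge young1 s K1).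
apply: (@le_trans _ _ (2 / e * Phi1 s)); last first.
  by rewrite ler_pM2r// le_max lexx orbT.
rewrite invf_ple ?posrE ?mulr_gt0 ?invr_gt0//; apply: le_trans TFge.
rewrite invfM invf_div mulrAC -mulrA ler_pM2l// ltW//.
by rewrite -lte_fin fineK.
Qed.

(** [M] is chosen before [A] because the supremum in (ii) needs one bound for all atoms. *)
Lemma young_inv_ratio_bound : exists M : R, forall A : set X, measurable A ->
  (0 < mu A < +oo)%E ->
  (eyoung_inv Phi1 (mu A)^-1 /
    eyoung_inv Phi2 ((ae_value mu f0 A)%:E * mu A)^-1 <= M%:E)%E.
Proof.
have [M M0 indicM] := bounded_composition_indic young1 young2 nsT CT.
exists M => A mA /andP[A0 Aoo].
have Afin : mu A \is a fin_num by rewrite ge0_fin_numE.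
have r0 : 0 < fine (mu A) by rewrite fine_gt0// A0.
(* Here the inverse of the product is [+oo], which [eyoung_inv] fixes, so the quotient is 0. *)
have trivial_case : ((ae_value mu f0 A)%:E * mu A = 0)%E ->
  (eyoung_inv Phi1 (mu A)^-1 /
    eyoung_inv Phi2 ((ae_value mu f0 A)%:E * mu A)^-1 <= M%:E)%E.
  by move=> ->; rewrite inve0 /= invey mule0 lee_fin ltW.
have [c0|TA] := ae_value_preimage f0E mA.
  by apply: trivial_case; rewrite c0 mul0e.
have [cA0|cA0] := eqVneq ((ae_value mu f0 A)%:E * mu A)%E 0%E.
  exact: trivial_case.
have TAfin := preimage_fin_num f0E mA Aoo.
have TA0 : (0 < mu (T @^-1` A))%E by rewrite lt0e TA cA0 -TA measure_ge0.
have q0 : 0 < fine (mu (T @^-1` A)) by rewrite fine_gt0// TA0 -ge0_fin_numE.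
have := indicM A mA; rewrite A0 Aoo TA0 -ge0_fin_numE// TAfin.
move=> /(_ isT isT) u12.
rewrite -TA -(fineK TAfin) -{1}(fineK Afin) !inver !gt_eqF//= inver.
have u2 : 0 < young_inv Phi2 (fine (mu (T @^-1` A)))^-1.
  by rewrite (young_inv_gt0 young2)// invr_gt0.
by rewrite gt_eqF// -EFinM lee_fin ler_pdivrMr.
Qed.

End composition_density.

Theorem theorem2p10 (d : measure_display) (X : measurableType d) (R : realType)
    (mu : {sigma_finite_measure set X -> \bar R})
    (mu_complete : measure_is_complete mu)
    (I : set nat) (A : nat -> set X) (B : set X)
    (decX : atomic_decomposition mu I A B)
    (T : {mfun X >-> X}) (nsT : nonsingular mu T)
    (f0 : X -> R) (f0E : density_of_preimage mu T f0)
    (Phi1 Phi2 : R -> R)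
    (young1 : young_function Phi1) (young2 : young_function Phi2)
    (not_prec : ~ young_prec Phi2 Phi1)
    (CT : bounded_composition mu Phi1 Phi2 T) :
  {ae mu, forall x, B x -> f0 x = 0} /\
  (ereal_sup [set eyoung_inv Phi1 (mu (A n))^-1 /
                  eyoung_inv Phi2 ((ae_value mu f0 (A n))%:E * mu (A n))^-1
             | n in I] < +oo)%E.
Proof.
split.
  apply: (density_ae_eq0 f0E (@sigma_finiteT _ _ _ mu)).
    exact: decomposition_measurable decX.
  (* A nonnull [E] in [B] with [f0 >= e] would make [Phi1] dominate [Phi2]. *)
  move=> E e mE EB Eoo e0 ef; apply: contrapT => /eqP E0; apply: not_prec.
  apply: (young_prec_nonatomic (decomposition_nonatomic decX) nsT f0E young1
    young2 CT mE EB _ e0 ef).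
  by rewrite lt0e E0 measure_ge0.
have [M ratioM] := young_inv_ratio_bound nsT f0E young1 young2 CT.
apply: (@le_lt_trans _ _ M%:E); last exact: ltry.
apply: ge_ereal_sup => _ [n In <-].
have [mAn An0 _] := decomposition_atom decX In.
by apply: ratioM => //; rewrite An0 (decomposition_fin decX In).
Qed.
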